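(* Let $\mathcal{G}$ be a strict 2-group presented by a crossed module $(G,H,\rhd,\partial)$ acting strictly on a small category $\mathbf{C}$, with action functor $\hat\Phi:\mathcal{G}\times\mathbf{C}\to\mathbf{C}$. Write $\mathcal{G}^{(0)}=G$ and $\mathcal{G}^{(1)}=G\ltimes H$ for the groups of objects and morphisms of $\mathcal{G}$ as a categorical group, $\mathbf{C}^{(0)},\mathbf{C}^{(1)}$ for the sets of objects and morphisms of $\mathbf{C}$, and $\hat\Phi^{(0)},\hat\Phi^{(1)}$ for the object and morphism maps of $\hat\Phi$. Then the transpose $\widetilde{\mathbf{C}/\!\!/\mathcal{G}}$ of the transformation $\mathbf{Cat}$-groupoid $\mathbf{C}/\!\!/\mathcal{G}$ is a category internal to the category $\mathbf{Gpd}$ of groupoids, with: - groupoid of objects $(\widetilde{\mathbf{C}/\!\!/\mathcal{G}})^{(0)}$ equal to the transformation groupoid $\mathbf{C}^{(0)}/\!\!/\mathcal{G}^{(0)}$ of the group action of $\mathcal{G}^{(0)}$ on the set $\mathbf{C}^{(0)}$ given by $\hat\Phi^{(0)}$; - groupoid of morphisms $(\widetilde{\mathbf{C}/\!\!/\mathcal{G}})^{(1)}$ equal to the transformation groupoid $\mathbf{C}^{(1)}/\!\!/\mathcal{G}^{(1)}$ of the group action of $\mathcal{G}^{(1)}$ on the set $\mathbf{C}^{(1)}$ given by $\hat\Phi^{(1)}$; - identity inclusion functor $\tilde e:\mathbf{C}^{(0)}/\!\!/\mathcal{G}^{(0)}\to\mathbf{C}^{(1)}/\!\!/\mathcal{G}^{(1)}$,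 source and target functors $\tilde s,\tilde t:\mathbf{C}^{(1)}/\!\!/\mathcal{G}^{(1)}\to\mathbf{C}^{(0)}/\!\!/\mathcal{G}^{(0)}$, and composition functor $\tilde\circ:(\mathbf{C}^{(1)}/\!\!/\mathcal{G}^{(1)})\times_{\mathbf{C}^{(0)}/\!\!/\mathcal{G}^{(0)}}(\mathbf{C}^{(1)}/\!\!/\mathcal{G}^{(1)})\to\mathbf{C}^{(1)}/\!\!/\mathcal{G}^{(1)}$ whose object maps are the corresponding structure maps (identity, source, target, composition) of the category $\mathbf{C}$ and whose morphism maps are those of the product category $\mathcal{G}\times\mathbf{C}$.
   Context: A crossed module $(G,H,\rhd,\partial)$ consists of groups $G,H$, an action $\rhd$ of $G$ on $H$ by automorphisms, and a homomorphism $\partial:H\to G$ with $\partial(g\rhd\eta)=g\,\partial(\eta)g^{-1}$ and $\partial(\eta)\rhd\zeta=\eta\zeta\eta^{-1}$. The 2-group $\mathcal{G}$ presented by it is the strict 2-category with one object, 1-morphisms the elements of $G$ (composition = multiplication), and 2-morphisms $(\gamma,\chi)\in G\times H$, $(\gamma,\chi):\gamma\Rightarrow\partial(\chi)\gamma$, with vertical composition $(\partial(\chi)\gamma,\chi')\cdot(\gamma,\chi)=(\gamma,\chi'\chi)$, identities $(\gamma,1_H)$, and horizontal composition $(\gamma_1,\chi_1)\circ(\gamma_3,\chi_2)=(\gamma_1\gamma_3,\chi_1(\gamma_1\rhd\chi_2))$. Equivalently, $\mathcal{G}$ is a categorical group: a category with objects $G$, morphisms $(\gamma,\chi):\gamma\to\partial(\chi)\gamma$,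 composition the vertical composition, and monoidal product $\otimes$ given by multiplication in $G$ on objects and by the horizontal composition on morphisms. Under $\otimes$, the objects form the group $G$ and the morphisms form the group $G\ltimes H$. A strict action of $\mathcal{G}$ on $\mathbf{C}$ is a strict 2-functor $\Phi:\mathcal{G}\to\mathbf{Cat}$ sending the unique object to $\mathbf{C}$: endofunctors $\Phi_\gamma$ and natural transformations $\Phi_{(\gamma,\chi)}:\Phi_\gamma\Rightarrow\Phi_{\partial(\chi)\gamma}$, strictly preserving all compositions and identities. The action functor is $\hat\Phi(\gamma,x)=\Phi_\gamma(x)$ on objects and $\hat\Phi((\gamma,\chi),f)=\Phi_{(\gamma,\chi)}(y)\circ\Phi_\gamma(f)$ for $f:x\to y$. Notation: $\gamma\blacktriangleright x=\hat\Phi(\gamma,x)$, $(\gamma,\chi)\blacktriangleright f=\hat\Phi((\gamma,\chi),f)$. The transformation $\mathbf{Cat}$-groupoid $\mathbf{C}/\!\!/\mathcal{G}$ is the groupoid internal to $\mathbf{Cat}$ with category of objects $\mathbf{C}$, category of morphisms $\mathcal{G}\times\mathbf{C}$, source functor the projection to $\mathbf{C}$, target functor $\hat\Phi$, identity inclusion $x\mapsto(1_G,x)$, $f\mapsto((1_G,1_H),f)$, and composition functor $(\gamma',\gamma\blacktriangleright x)\circ(\gamma,x)=(\gamma'\gamma,x)$ on objects and $((\gamma_1,\chi_1),(\gamma_3,\chi_2)\blacktriangleright f)\circ((\gamma_3,\chi_2),f)=((\gamma_1\gamma_3,\chi_1(\gamma_1\rhd\chi_2)),f)$ on morphisms. Transpose: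 for a category $\mathcal{D}$ internal to $\mathbf{Cat}$, with category of objects $\mathcal{D}^{(0)}$ and category of morphisms $\mathcal{D}^{(1)}$, the transpose $\widetilde{\mathcal{D}}$ is the category internal to $\mathbf{Cat}$ whose category of objects has as objects the objects of $\mathcal{D}^{(0)}$ and as morphisms the objects of $\mathcal{D}^{(1)}$, whose category of morphisms has as objects the morphisms of $\mathcal{D}^{(0)}$ and as morphisms the morphisms of $\mathcal{D}^{(1)}$ (these two categories having the structure maps given by the object maps, respectively morphism maps, of the structure functors of $\mathcal{D}$), and whose identity, source, target and composition functors have as object maps the structure maps of the category $\mathcal{D}^{(0)}$ and as morphism maps the structure maps of the category $\mathcal{D}^{(1)}$. For a group $K$ acting on a set $X$, the transformation groupoid $X/\!\!/K$ has objects $X$, morphisms $(k,x)\in K\times X$ with source $x$ and target $k\cdot x$, and composition $(k',k\cdot x)\circ(k,x)=(k'k,x)$. *)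

(* Defs.v *)
From HB Require Import structures.
From mathcomp Require Import all_boot.
From mathcomp Require Import boolp.

Set Implicit Arguments.
Unset Strict Implicit.
Unset Printing Implicit Defensive.

Local Open Scope group_scope.

(* Small categories are presented by a set of objects and a single set of
   morphisms; [compm g f] is "g after f".  Laws that mention composites quantify
   over the (irrelevant) proofs of composability. *)
Record category := Category {
  Ob : Type;
  Mor : Type;
  src : Mor -> Ob;
  tgt : Mor -> Ob;
  idm : Ob -> Mor;
  compm : forall g f : Mor, src g = tgt f -> Mor;
  src_idm : forall x, src (idm x) = x;
  tgt_idm : forall x, tgt (idm x) = x;
  src_comp : forall g f (p : src g = tgt f), src (compm p) = src f;
  tgt_comp : forall g f (p : src g = tgt f), tgt (compm p) = tgt g;
  comp_idl : forall f (p : src (idm (tgt f)) = tgt f), compm p = f;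
  comp_idr : forall f (p : src f = tgt (idm (src f))), compm p = f;
  comp_assoc : forall h g f (p : src h = tgt g) (q : src g = tgt f)
      (p' : src h = tgt (compm q)) (q' : src (compm p) = tgt f),
    compm p' = compm q'
}.

Arguments src {_} _.
Arguments tgt {_} _.
Arguments idm {_} _.
Arguments compm {_} g f _.

Record functor (C D : category) := Functor {
  fob : Ob C -> Ob D;
  fmor : Mor C -> Mor D;
  fmor_src : forall f, src (fmor f) = fob (src f);
  fmor_tgt : forall f, tgt (fmor f) = fob (tgt f);
  fmor_idm : forall x, fmor (idm x) = idm (fob x);
  fmor_comp : forall g f (p : src g = tgt f) (q : src (fmor g) = tgt (fmor f)),
    fmor (compm g f p) = compm (fmor g) (fmor f) q
}.

Lemma comp_congr (C : category) (g g' f f' : Mor C) p p' :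
  g = g' -> f = f' -> compm g f p = compm g' f' p'.
Proof.
by move=> eg ef; move: p p'; rewrite eg ef => p p'; rewrite (Prop_irrelevance p p').
Qed.

Lemma functor_eq (C D : category) (F F' : functor C D) :
  (forall x, fob F x = fob F' x) -> (forall f, fmor F f = fmor F' f) -> F = F'.
Proof.
case: F => o m a1 a2 a3 a4; case: F' => o' m' b1 b2 b3 b4 /= eo em.
have {}eo : o = o' by apply/funext.
have {}em : m = m' by apply/funext.
move: a1 a2 a3 a4 b1 b2 b3 b4; rewrite eo em => *.
by congr Functor; exact: Prop_irrelevance.
Qed.

Lemma fob_congr (C D : category) (F F' : functor C D) x :
  F = F' -> fob F x = fob F' x.
Proof. by move=> ->. Qed.

Lemma fmor_congr (C D : category) (F F' : functor C D) f :
  F = F' -> fmor F f = fmor F' f.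
Proof. by move=> ->. Qed.

Definition functor_id (C : category) : functor C C :=
  @Functor C C id id (fun=> erefl) (fun=> erefl) (fun=> erefl)
    (fun g f p q => comp_congr p q erefl erefl).

Section FunctorComp.
Variables (B C D : category) (K : functor C D) (F : functor B C).

Lemma functor_comp_src f : src (fmor K (fmor F f)) = fob K (fob F (src f)).
Proof. by rewrite !fmor_src. Qed.
Lemma functor_comp_tgt f : tgt (fmor K (fmor F f)) = fob K (fob F (tgt f)).
Proof. by rewrite !fmor_tgt. Qed.
Lemma functor_comp_idm x : fmor K (fmor F (idm x)) = idm (fob K (fob F x)).
Proof. by rewrite !fmor_idm. Qed.
Lemma functor_comp_comp g f p q :
  fmor K (fmor F (compm g f p)) =
    compm (fmor K (fmor F g)) (fmor K (fmor F f)) q.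
Proof.
have p' : src (fmor F g) = tgt (fmor F f) by rewrite fmor_src fmor_tgt p.
by rewrite (fmor_comp p p') (fmor_comp p' q).
Qed.

Definition functor_comp : functor B D :=
  Functor functor_comp_src functor_comp_tgt functor_comp_idm functor_comp_comp.
End FunctorComp.

Section ProdCat.
Variables A B : category.

Lemma prod_cat_composable (g f : Mor A * Mor B) :
  (src g.1, src g.2) = (tgt f.1, tgt f.2) ->
  (src g.1 = tgt f.1) * (src g.2 = tgt f.2).
Proof. by case. Qed.

Definition prod_cat : category.
Proof.
refine (@Category (Ob A * Ob B)%type (Mor A * Mor B)%type
  (fun f => (src f.1, src f.2)) (fun f => (tgt f.1, tgt f.2))
  (fun x => (idm x.1, idm x.2))
  (fun g f p => (compm g.1 f.1 (prod_cat_composable p).1,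
                 compm g.2 f.2 (prod_cat_composable p).2))
  _ _ _ _ _ _ _).
- by case=> x y; rewrite /= !src_idm.
- by case=> x y; rewrite /= !tgt_idm.
- by move=> g f p /=; rewrite !src_comp.
- by move=> g f p /=; rewrite !tgt_comp.
- by move=> [f1 f2] p /=; rewrite !comp_idl.
- by move=> [f1 f2] p /=; rewrite !comp_idr.
- by move=> h g f p q p' q' /=; congr pair; exact: comp_assoc.
Defined.

End ProdCat.

Definition prod_snd (A B : category) : functor (prod_cat A B) B :=
  @Functor (prod_cat A B) B snd snd (fun=> erefl) (fun=> erefl) (fun=> erefl)
    (fun g f p q => comp_congr _ q erefl erefl).

Lemma sig_eq (T : Type) (P : T -> Prop) (x y : {t | P t}) :
  proj1_sig x = proj1_sig y -> x = y.
Proof.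
case: x y => [x px] [y py] /= exy; move: px py; rewrite exy => px py.
by rewrite (Prop_irrelevance px py).
Qed.

(* The strict pullback  A x_C B  of small categories. *)
Section Pullback.
Variables (A B C : category) (S : functor A C) (T : functor B C).

Definition pb_ob := {p : Ob A * Ob B | fob S p.1 = fob T p.2}.
Definition pb_mor := {p : Mor A * Mor B | fmor S p.1 = fmor T p.2}.

Lemma pb_src_subproof (f : pb_mor) :
  fob S (src (sval f).1) = fob T (src (sval f).2).
Proof. by rewrite -!fmor_src (svalP f). Qed.

Lemma pb_tgt_subproof (f : pb_mor) :
  fob S (tgt (sval f).1) = fob T (tgt (sval f).2).
Proof. by rewrite -!fmor_tgt (svalP f). Qed.

Lemma pb_idm_subproof (x : pb_ob) :
  fmor S (idm (sval x).1) = fmor T (idm (sval x).2).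
Proof. by rewrite !fmor_idm (svalP x). Qed.

Definition pb_src (f : pb_mor) : pb_ob :=
  exist _ (src (sval f).1, src (sval f).2) (pb_src_subproof f).
Definition pb_tgt (f : pb_mor) : pb_ob :=
  exist _ (tgt (sval f).1, tgt (sval f).2) (pb_tgt_subproof f).
Definition pb_idm (x : pb_ob) : pb_mor :=
  exist _ (idm (sval x).1, idm (sval x).2) (pb_idm_subproof x).

Lemma pb_composable (g f : pb_mor) : pb_src g = pb_tgt f ->
  (src (sval g).1 = tgt (sval f).1) * (src (sval g).2 = tgt (sval f).2).
Proof. by move/(congr1 sval) => /= -[]. Qed.

Lemma pb_comp_subproof (g f : pb_mor) (p : pb_src g = pb_tgt f) :
  fmor S (compm (sval g).1 (sval f).1 (pb_composable p).1) =
  fmor T (compm (sval g).2 (sval f).2 (pb_composable p).2).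
Proof.
have [p1 p2] := pb_composable p.
have q1 : src (fmor S (sval g).1) = tgt (fmor S (sval f).1).
  by rewrite fmor_src fmor_tgt p1.
have q2 : src (fmor T (sval g).2) = tgt (fmor T (sval f).2).
  by rewrite fmor_src fmor_tgt p2.
rewrite (fmor_comp _ q1) (fmor_comp _ q2).
by apply: comp_congr; [exact: (svalP g) | exact: (svalP f)].
Qed.

Definition pb_comp (g f : pb_mor) (p : pb_src g = pb_tgt f) : pb_mor :=
  exist _ (compm (sval g).1 (sval f).1 (pb_composable p).1,
           compm (sval g).2 (sval f).2 (pb_composable p).2) (pb_comp_subproof p).

Definition pullback : category.
Proof.
refine (@Category pb_ob pb_mor pb_src pb_tgt pb_idm pb_comp _ _ _ _ _ _ _).
- by move=> x; apply: sig_eq; rewrite /= !src_idm -surjective_pairing.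
- by move=> x; apply: sig_eq; rewrite /= !tgt_idm -surjective_pairing.
- by move=> g f p; apply: sig_eq; rewrite /= !src_comp.
- by move=> g f p; apply: sig_eq; rewrite /= !tgt_comp.
- by move=> f p; apply: sig_eq; rewrite /= !comp_idl -surjective_pairing.
- by move=> f p; apply: sig_eq; rewrite /= !comp_idr -surjective_pairing.
- move=> h g f p q p' q'; apply: sig_eq => /=.
  by congr pair; exact: comp_assoc.
Defined.

Definition pb_fst : functor pullback A.
Proof.
refine (@Functor pullback A (fun x => (sval x).1) (fun f => (sval f).1)
  (fun=> erefl) (fun=> erefl) (fun=> erefl) _).
by move=> g f p q; exact: comp_congr.
Defined.

Definition pb_snd : functor pullback B.
Proof.
refine (@Functor pullback B (fun x => (sval x).2) (fun f => (sval f).2)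
  (fun=> erefl) (fun=> erefl) (fun=> erefl) _).
by move=> g f p q; exact: comp_congr.
Defined.

Lemma pb_comm : functor_comp S pb_fst = functor_comp T pb_snd.
Proof. by apply: functor_eq => x; exact: (svalP x). Qed.

Section Pairing.
Variables (Z : category) (U : functor Z A) (V : functor Z B).
Hypothesis e : functor_comp S U = functor_comp T V.

Definition pb_pair : functor Z pullback.
Proof.
refine (@Functor Z pullback
  (fun z => exist _ (fob U z, fob V z) (congr1 (fun F => fob F z) e))
  (fun f => exist _ (fmor U f, fmor V f) (congr1 (fun F => fmor F f) e))
  _ _ _ _).
- by move=> f; apply: sig_eq; rewrite /= !fmor_src.
- by move=> f; apply: sig_eq; rewrite /= !fmor_tgt.
- by move=> x; apply: sig_eq; rewrite /= !fmor_idm.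
- by move=> g f p q; apply: sig_eq; congr pair; exact: fmor_comp.
Defined.

End Pairing.

End Pullback.

(* Large categories equipped with a choice of pullbacks. *)
Record pullback_category := PullbackCategory {
  pc_ob :> Type;
  pc_hom : pc_ob -> pc_ob -> Type;
  pc_id : forall a, pc_hom a a;
  pc_comp : forall a b c, pc_hom b c -> pc_hom a b -> pc_hom a c;
  pc_idl : forall a b (f : pc_hom a b), pc_comp (pc_id b) f = f;
  pc_idr : forall a b (f : pc_hom a b), pc_comp f (pc_id a) = f;
  pc_assoc : forall a b c d
      (h : pc_hom c d) (g : pc_hom b c) (f : pc_hom a b),
    pc_comp h (pc_comp g f) = pc_comp (pc_comp h g) f;
  pc_pb : forall a b c, pc_hom a c -> pc_hom b c -> pc_ob;
  pc_fst : forall a b c (s : pc_hom a c) (t : pc_hom b c), pc_hom (pc_pb s t) a;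
  pc_snd : forall a b c (s : pc_hom a c) (t : pc_hom b c), pc_hom (pc_pb s t) b;
  pc_comm : forall a b c (s : pc_hom a c) (t : pc_hom b c),
    pc_comp s (pc_fst s t) = pc_comp t (pc_snd s t);
  pc_pair : forall a b c (s : pc_hom a c) (t : pc_hom b c)
      z (u : pc_hom z a) (v : pc_hom z b),
    pc_comp s u = pc_comp t v -> pc_hom z (pc_pb s t);
  pc_fst_pair : forall a b c (s : pc_hom a c) (t : pc_hom b c)
      z (u : pc_hom z a) (v : pc_hom z b) (e : pc_comp s u = pc_comp t v),
    pc_comp (pc_fst s t) (pc_pair e) = u;
  pc_snd_pair : forall a b c (s : pc_hom a c) (t : pc_hom b c)
      z (u : pc_hom z a) (v : pc_hom z b) (e : pc_comp s u = pc_comp t v),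
    pc_comp (pc_snd s t) (pc_pair e) = v;
  pc_pair_uniq : forall a b c (s : pc_hom a c) (t : pc_hom b c)
      z (w w' : pc_hom z (pc_pb s t)),
    pc_comp (pc_fst s t) w = pc_comp (pc_fst s t) w' ->
    pc_comp (pc_snd s t) w = pc_comp (pc_snd s t) w' -> w = w'
}.

Arguments pc_hom {_} _ _.
Arguments pc_id {_} _.
Arguments pc_comp {_ _ _ _} _ _.
Arguments pc_pb {_ _ _ _} _ _.
Arguments pc_fst {_ _ _ _} _ _.
Arguments pc_snd {_ _ _ _} _ _.
Arguments pc_pair {_ _ _ _ _ _ _ _ _} _.

Notation "g \oc f" := (pc_comp g f) (at level 40, left associativity).

Definition Cat : pullback_category.
Proof.
refine (@PullbackCategory category functor functor_id functor_comp
  _ _ _ pullback pb_fst pb_snd pb_comm pb_pair _ _ _).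
- by move=> a b f; exact: functor_eq.
- by move=> a b f; exact: functor_eq.
- by move=> a b c d h g f; exact: functor_eq.
- by move=> *; exact: functor_eq.
- by move=> *; exact: functor_eq.
- move=> a b c s t z w w' e1 e2; apply: functor_eq => x; apply: sig_eq.
    move: (congr1 (fun F => fob F x) e1) (congr1 (fun F => fob F x) e2) => /=.
    by case: (sval _) (sval _) => [? ?] [? ?] /= -> ->.
  move: (congr1 (fun F => fmor F x) e1) (congr1 (fun F => fmor F x) e2) => /=.
  by case: (sval _) (sval _) => [? ?] [? ?] /= -> ->.
Defined.

(* Unfold the structure [Cat] before the operations on functors it packages. *)
Strategy expand [pc_ob pc_hom pc_id pc_comp pc_pb pc_fst pc_snd pc_pair Cat].

Definition is_groupoid (C : category) : Prop :=
  forall f : Mor C, exists (f' : Mor C) (p : src f' = tgt f) (q : src f = tgt f'),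
    compm f' f p = idm (src f) /\ compm f f' q = idm (tgt f).

Lemma pullback_is_groupoid (A B C : category)
    (S : functor A C) (T : functor B C) :
  is_groupoid A -> is_groupoid B -> is_groupoid (pullback S T).
Proof.
move=> gA gB [[f g] /= e].
have [f' [p [q [l r]]]] := gA f.
have [g' [p' [q' [l' r']]]] := gB g.
have e' : fmor S f' = fmor T g'.
  (* Both are the inverse of [fmor S f] in [C]. *)
  have inv_uniq (h k k' : Mor C) p1 p2 :
      compm k h p1 = idm (src h) -> compm h k' p2 = idm (tgt h) -> k = k'.
    move=> e1 e2.
    have p3 : src k = tgt (compm h k' p2) by rewrite tgt_comp.
    have p4 : src (compm k h p1) = tgt k' by rewrite src_comp.
    have := comp_assoc p3 p4.
    have -> : compm k (compm h k' p2) p3 = k.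
      have p5 : src k = tgt (idm (src k)) by rewrite tgt_idm.
      by rewrite -[RHS](comp_idr p5); apply: comp_congr; rewrite // e2 p1.
    move=> ->.
    have p5 : src (idm (tgt k')) = tgt k' by rewrite src_idm.
    by rewrite -[RHS](comp_idl p5); apply: comp_congr; rewrite // e1 p2.
  have a1 : src (fmor S f') = tgt (fmor S f) by rewrite fmor_src fmor_tgt p.
  have a2 : src (fmor T g) = tgt (fmor T g') by rewrite fmor_src fmor_tgt q'.
  have a3 : src (fmor S f) = tgt (fmor T g') by rewrite e a2.
  apply: (inv_uniq (fmor S f) _ _ a1 a3).
    by rewrite -(fmor_comp p) l fmor_idm fmor_src.
  rewrite (@comp_congr _ _ (fmor T g) _ (fmor T g') a3 a2) //.
  by rewrite -(fmor_comp q') r' fmor_idm e fmor_tgt.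
pose i : Mor (pullback S T) := exist _ (f', g') e'.
have P : src i = tgt (exist _ (f, g) e : Mor (pullback S T)).
  by apply: sig_eq; rewrite /= p p'.
have Q : src (exist _ (f, g) e : Mor (pullback S T)) = tgt i.
  by apply: sig_eq; rewrite /= q q'.
exists i, P, Q; split; apply: sig_eq => /=; congr pair.
- by rewrite -l; exact: comp_congr.
- by rewrite -l'; exact: comp_congr.
- by rewrite -r; exact: comp_congr.
- by rewrite -r'; exact: comp_congr.
Qed.

(* The full subcategory of [E] on the objects satisfying [P], when [P] is stable
   under the chosen pullbacks of [E]. *)
Section FullSub.
Variables (E : pullback_category) (P : E -> Prop).
Hypothesis P_pb : forall (a b c : E) (s : pc_hom a c) (t : pc_hom b c),
  P a -> P b -> P (pc_pb s t).

Record full_ob := FullOb { fs_val :> E; fs_prop : P fs_val }.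

Definition full_sub : pullback_category :=
  @PullbackCategory full_ob (fun a b => pc_hom (fs_val a) (fs_val b))
    (fun a => pc_id (fs_val a)) (fun _ _ _ g f => g \oc f)
    (fun _ _ => @pc_idl E _ _) (fun _ _ => @pc_idr E _ _)
    (fun _ _ _ _ => @pc_assoc E _ _ _ _)
    (fun a b _ s t => FullOb (P_pb s t (fs_prop a) (fs_prop b)))
    (fun _ _ _ s t => pc_fst s t) (fun _ _ _ s t => pc_snd s t)
    (fun _ _ _ s t => pc_comm s t) (fun _ _ _ s t _ u v e => pc_pair e)
    (fun _ _ _ _ _ _ => @pc_fst_pair E _ _ _ _ _ _)
    (fun _ _ _ _ _ _ => @pc_snd_pair E _ _ _ _ _ _)
    (fun _ _ _ _ _ _ => @pc_pair_uniq E _ _ _ _ _ _).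

End FullSub.

Arguments full_ob {E} P.

Definition groupoid := @full_ob Cat is_groupoid.
Definition gpd_cat (A : groupoid) : category := fs_val A.
Coercion gpd_cat : groupoid >-> category.

Definition Gpd : pullback_category := @full_sub Cat is_groupoid pullback_is_groupoid.

(* The axioms of a category internal to [E].  The compatibility proofs needed
   to form pairings into pullbacks are universally quantified; they all follow
   from [ic_se], [ic_te], [ic_sc], [ic_tc]. *)
Record is_internal_cat (E : pullback_category) (D0 D1 : E)
    (s t : pc_hom D1 D0) (e : pc_hom D0 D1) (c : pc_hom (pc_pb s t) D1) : Prop := {
  ic_se : s \oc e = pc_id D0;
  ic_te : t \oc e = pc_id D0;
  ic_sc : s \oc c = s \oc pc_snd s t;
  ic_tc : t \oc c = t \oc pc_fst s t;
  ic_idl : forall p : s \oc (e \oc t) = t \oc pc_id D1,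
    c \oc pc_pair p = pc_id D1;
  ic_idr : forall p : s \oc pc_id D1 = t \oc (e \oc s),
    c \oc pc_pair p = pc_id D1;
  ic_assoc :
    let pr12 := pc_fst (s \oc pc_snd s t) t in
    let h := pc_fst s t \oc pr12 in
    let g := pc_snd s t \oc pr12 in
    let f := pc_snd (s \oc pc_snd s t) t in
    forall (p : s \oc (c \oc pr12) = t \oc f)
      (q : s \oc g = t \oc f)
      (r : s \oc h = t \oc (c \oc pc_pair q)),
    c \oc pc_pair p = c \oc pc_pair r
}.

Record internal_cat (E : pullback_category) := InternalCat {
  ic_ob : E;
  ic_mor : E;
  ic_s : pc_hom ic_mor ic_ob;
  ic_t : pc_hom ic_mor ic_ob;
  ic_e : pc_hom ic_ob ic_mor;
  ic_c : pc_hom (pc_pb ic_s ic_t) ic_mor;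
  ic_axioms : is_internal_cat ic_e ic_c
}.

Record internal_groupoid (E : pullback_category) := InternalGroupoid {
  ig_cat :> internal_cat E;
  ig_inverse : let s := ic_s ig_cat in let t := ic_t ig_cat in
    exists i : pc_hom (ic_mor ig_cat) (ic_mor ig_cat),
    exists (p : s \oc i = t \oc pc_id _) (q : s \oc pc_id _ = t \oc i),
      ic_c ig_cat \oc pc_pair p = ic_e ig_cat \oc s /\
      ic_c ig_cat \oc pc_pair q = ic_e ig_cat \oc t
}.

Section OfFullSub.
Variables (E : pullback_category) (P : E -> Prop).
Hypothesis P_pb : forall (a b c : E) (s : pc_hom a c) (t : pc_hom b c),
  P a -> P b -> P (pc_pb s t).

Lemma is_internal_cat_of_full (D0 D1 : full_sub P_pb)
    (s t : pc_hom (fs_val D1) (fs_val D0)) (e : pc_hom (fs_val D0) (fs_val D1))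
    (c : pc_hom (pc_pb s t) (fs_val D1)) :
  @is_internal_cat (full_sub P_pb) D0 D1 s t e c -> is_internal_cat e c.
Proof.
by case=> a1 a2 a3 a4 a5 a6 a7; split;
  [exact a1|exact a2|exact a3|exact a4|exact a5|exact a6|exact a7].
Qed.

Definition internal_cat_of_full (D : internal_cat (full_sub P_pb)) :
    internal_cat E :=
  @InternalCat E _ _ _ _ _ _ (is_internal_cat_of_full (ic_axioms D)).

End OfFullSub.

Definition internal_cat_of_Gpd (D : internal_cat Gpd) : internal_cat Cat :=
  internal_cat_of_full D.

Section Transpose.
Variable D : internal_cat Cat.

Let D0 : category := ic_ob D.
Let D1 : category := ic_mor D.
Let s : functor D1 D0 := ic_s D.
Let t : functor D1 D0 := ic_t D.
Let e : functor D0 D1 := ic_e D.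
Let c : functor (pullback s t) D1 := ic_c D.

Let cob (g f : Ob D1) (p : fob s g = fob t f) : Ob D1 := fob c (exist _ (g, f) p).
Let cmor (g f : Mor D1) (p : fmor s g = fmor t f) : Mor D1 :=
  fmor c (exist _ (g, f) p).

Let ax : @is_internal_cat Cat D0 D1 s t e c := ic_axioms D.

Lemma tr_se : functor_comp s e = functor_id D0. Proof. exact: ic_se ax. Qed.
Lemma tr_te : functor_comp t e = functor_id D0. Proof. exact: ic_te ax. Qed.
Lemma tr_sc : functor_comp s c = functor_comp s (pb_snd s t).
Proof. exact: ic_sc ax. Qed.
Lemma tr_tc : functor_comp t c = functor_comp t (pb_fst s t).
Proof. exact: ic_tc ax. Qed.

Lemma tr_idl_compat :
  functor_comp s (functor_comp e t) = functor_comp t (functor_id D1).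
Proof. by apply: functor_eq => x /=; [rewrite -[LHS]/(fob (functor_comp s e) _)|
  rewrite -[LHS]/(fmor (functor_comp s e) _)]; rewrite tr_se. Qed.
Lemma tr_idl : functor_comp c (pb_pair tr_idl_compat) = functor_id D1.
Proof. exact: (ic_idl ax tr_idl_compat). Qed.

Lemma tr_idr_compat :
  functor_comp s (functor_id D1) = functor_comp t (functor_comp e s).
Proof. by apply: functor_eq => x /=; [rewrite -[RHS]/(fob (functor_comp t e) _)|
  rewrite -[RHS]/(fmor (functor_comp t e) _)]; rewrite tr_te. Qed.
Lemma tr_idr : functor_comp c (pb_pair tr_idr_compat) = functor_id D1.
Proof. exact: (ic_idr ax tr_idr_compat). Qed.

Let s2 := functor_comp s (pb_snd s t).
Let pr12 := pb_fst s2 t.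
Let th := functor_comp (pb_fst s t) pr12.
Let tg := functor_comp (pb_snd s t) pr12.
Let tf := pb_snd s2 t.

Lemma tr_assoc_compat1 : functor_comp s (functor_comp c pr12) = functor_comp t tf.
Proof.
apply: functor_eq => x /=.
  rewrite -[LHS]/(fob (functor_comp s c) _) tr_sc; exact: (svalP x).
rewrite -[LHS]/(fmor (functor_comp s c) _) tr_sc; exact: (svalP x).
Qed.
Lemma tr_assoc_compat2 : functor_comp s tg = functor_comp t tf.
Proof. by apply: functor_eq => x; exact: (svalP x). Qed.
Lemma tr_assoc_compat3 :
  functor_comp s th = functor_comp t (functor_comp c (pb_pair tr_assoc_compat2)).
Proof.
apply: functor_eq => x /=.
  rewrite -[RHS]/(fob (functor_comp t c) _) tr_tc; exact: (svalP (sval x).1).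
rewrite -[RHS]/(fmor (functor_comp t c) _) tr_tc; exact: (svalP (sval x).1).
Qed.
Lemma tr_assoc : functor_comp c (pb_pair tr_assoc_compat1) =
  functor_comp c (pb_pair tr_assoc_compat3).
Proof. exact: (ic_assoc ax tr_assoc_compat1 tr_assoc_compat3). Qed.

Lemma cob_congr g g' f f' p p' : g = g' -> f = f' -> @cob g f p = @cob g' f' p'.
Proof. by move=> eg ef; congr (fob c _); apply: sig_eq; rewrite /= eg ef. Qed.
Lemma cmor_congr g g' f f' p p' : g = g' -> f = f' -> @cmor g f p = @cmor g' f' p'.
Proof. by move=> eg ef; congr (fmor c _); apply: sig_eq; rewrite /= eg ef. Qed.

Definition transpose_ob : category.
Proof.
refine (@Category (Ob D0) (Ob D1) (fob s) (fob t) (fob e) cob _ _ _ _ _ _ _).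
- by move=> x; exact (fob_congr x tr_se).
- by move=> x; exact (fob_congr x tr_te).
- by move=> g f p; exact (fob_congr (exist _ (g, f) p : Ob (pullback s t)) tr_sc).
- by move=> g f p; exact (fob_congr (exist _ (g, f) p : Ob (pullback s t)) tr_tc).
- move=> f p; rewrite -[RHS](fob_congr f tr_idl).
  exact: cob_congr.
- move=> f p; rewrite -[RHS](fob_congr f tr_idr).
  exact: cob_congr.
- move=> h g f p q p' q'.
  pose x : Ob (pullback s2 t) :=
    exist (fun y => fob s2 y.1 = fob t y.2) (exist _ (h, g) p, f) q.
  transitivity (fob (functor_comp c (pb_pair tr_assoc_compat3)) x).
    by apply: cob_congr => //; exact: cob_congr.
  rewrite -(fob_congr x tr_assoc).
  by apply: cob_congr => //; exact: cob_congr.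
Defined.

Definition transpose_mor : category.
Proof.
refine (@Category (Mor D0) (Mor D1) (fmor s) (fmor t) (fmor e) cmor
  _ _ _ _ _ _ _).
- by move=> x; exact (fmor_congr x tr_se).
- by move=> x; exact (fmor_congr x tr_te).
- by move=> g f p; exact (fmor_congr (exist _ (g, f) p : Mor (pullback s t)) tr_sc).
- by move=> g f p; exact (fmor_congr (exist _ (g, f) p : Mor (pullback s t)) tr_tc).
- move=> f p; rewrite -[RHS](fmor_congr f tr_idl).
  exact: cmor_congr.
- move=> f p; rewrite -[RHS](fmor_congr f tr_idr).
  exact: cmor_congr.
- move=> h g f p q p' q'.
  pose x : Mor (pullback s2 t) :=
    exist (fun y => fmor s2 y.1 = fmor t y.2) (exist _ (h, g) p, f) q.
  transitivity (fmor (functor_comp c (pb_pair tr_assoc_compat3)) x).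
    by apply: cmor_congr => //; exact: cmor_congr.
  rewrite -(fmor_congr x tr_assoc).
  by apply: cmor_congr => //; exact: cmor_congr.
Defined.

Definition transpose_s : functor transpose_mor transpose_ob.
Proof.
refine (@Functor transpose_mor transpose_ob (@src D0) (@src D1) _ _ _ _).
- by move=> f; rewrite /= fmor_src.
- by move=> f; rewrite /= fmor_src.
- by move=> f; rewrite /= fmor_src.
- by move=> g f p q; rewrite /= fmor_src /=; apply: cob_congr.
Defined.

Definition transpose_t : functor transpose_mor transpose_ob.
Proof.
refine (@Functor transpose_mor transpose_ob (@tgt D0) (@tgt D1) _ _ _ _).
- by move=> f; rewrite /= fmor_tgt.
- by move=> f; rewrite /= fmor_tgt.
- by move=> f; rewrite /= fmor_tgt.
- by move=> g f p q; rewrite /= fmor_tgt /=; apply: cob_congr.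
Defined.

Definition transpose_e : functor transpose_ob transpose_mor.
Proof.
refine (@Functor transpose_ob transpose_mor (@idm D0) (@idm D1) _ _ _ _).
- by move=> f; rewrite /= fmor_idm.
- by move=> f; rewrite /= fmor_idm.
- by move=> f; rewrite /= fmor_idm.
- move=> g f p q; rewrite /= /cob /cmor -fmor_idm; congr fmor.
  exact: sig_eq.
Defined.

Definition transpose_c : functor (pullback transpose_s transpose_t) transpose_mor.
Proof.
refine (@Functor (pullback transpose_s transpose_t) transpose_mor
  (fun x => @compm D0 (sval x).1 (sval x).2 (svalP x))
  (fun m => @compm D1 (sval m).1 (sval m).2 (svalP m)) _ _ _ _).
- move=> [[m' m] /= p].
  have q : src (fmor s m') = tgt (fmor s m) by rewrite fmor_src fmor_tgt p.
  by rewrite (fmor_comp _ q); exact: comp_congr.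
- move=> [[m' m] /= p].
  have q : src (fmor t m') = tgt (fmor t m) by rewrite fmor_src fmor_tgt p.
  by rewrite (fmor_comp _ q); exact: comp_congr.
- move=> [[g f] /= p].
  have q : src (fmor e g) = tgt (fmor e f) by rewrite fmor_src fmor_tgt p.
  by rewrite (fmor_comp _ q); exact: comp_congr.
- move=> [[n' n] /= pn] [[m' m] /= pm] p q.
  have /= [p1 p2] := pb_composable p.
  pose G : Mor (pullback s t) := exist _ (n', m') p1.
  pose F : Mor (pullback s t) := exist _ (n, m) p2.
  have GF : src G = tgt F by apply: sig_eq; rewrite /= pn pm.
  have cGF : src (fmor c G) = tgt (fmor c F).
    by rewrite fmor_src fmor_tgt GF.
  transitivity (compm (fmor c G) (fmor c F) cGF).
    by apply: comp_congr; exact: cmor_congr.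
  rewrite -(fmor_comp GF); congr fmor; apply: sig_eq => /=.
  by congr pair; exact: comp_congr.
Defined.

Lemma transpose_axioms :
  @is_internal_cat Cat transpose_ob transpose_mor transpose_s transpose_t
    transpose_e transpose_c.
Proof.
split.
- apply: functor_eq => x; [exact: (@src_idm D0) | exact: (@src_idm D1)].
- apply: functor_eq => x; [exact: (@tgt_idm D0) | exact: (@tgt_idm D1)].
- apply: functor_eq => x; [exact: (@src_comp D0) | exact: (@src_comp D1)].
- apply: functor_eq => x; [exact: (@tgt_comp D0) | exact: (@tgt_comp D1)].
- move=> p; apply: functor_eq => x; [exact: (@comp_idl D0) | exact: (@comp_idl D1)].
- move=> p; apply: functor_eq => x; [exact: (@comp_idr D0) | exact: (@comp_idr D1)].
- move=> pr12' h g f p q r; apply: functor_eq => x; symmetry;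
    [exact: (@comp_assoc D0) | exact: (@comp_assoc D1)].
Qed.

Definition transpose : internal_cat Cat := InternalCat transpose_axioms.

End Transpose.

Record crossed_module (G H : groupType) := CrossedModule {
  xact : G -> H -> H;
  xbd : {multiplicative H -> G};
  xact1 : forall eta, xact 1 eta = eta;
  xactM : forall g g' eta, xact (g * g') eta = xact g (xact g' eta);
  xact_mul : forall g eta zeta, xact g (eta * zeta) = xact g eta * xact g zeta;
  xbd_act : forall g eta, xbd (xact g eta) = g * xbd eta * g^-1;
  peiffer : forall eta zeta, xact (xbd eta) zeta = eta * zeta * eta^-1
}.

(* The carrier of the semidirect product of G and H: an alias of G * H that does
   not carry the group structure of the direct product. *)
Definition semidirect (G H : groupType) (X : crossed_module G H) : Type :=
  (G * H)%type.
HB.instance Definition _ (G H : groupType) (X : crossed_module G H) :=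
  Choice.on (semidirect X).

Section SemiDirect.
Variables (G H : groupType) (X : crossed_module G H).

Lemma xact_one g : xact X g 1 = 1.
Proof. by apply: (mulgI (xact X g 1)); rewrite -xact_mul !mulg1. Qed.

Lemma xbd1 : xbd X 1 = 1.
Proof. by apply: (mulgI (xbd X 1)); rewrite -gmulfM !mulg1. Qed.

Lemma xbdV eta : xbd X eta^-1 = (xbd X eta)^-1.
Proof. by apply: (mulgI (xbd X eta)); rewrite -gmulfM !mulgV xbd1. Qed.

Definition sd_mul (a b : semidirect X) : semidirect X :=
  (a.1 * b.1, a.2 * xact X a.1 b.2).
Definition sd_one : semidirect X := (1, 1).
Definition sd_inv (a : semidirect X) : semidirect X :=
  (a.1^-1, xact X a.1^-1 a.2^-1).

Lemma sd_mulA : associative sd_mul.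
Proof. by move=> a b c; rewrite /sd_mul /= xact_mul xactM !mulgA. Qed.
Lemma sd_mul1 : left_id sd_one sd_mul.
Proof. by case=> g h; rewrite /sd_mul /= xact1 !mul1g. Qed.
Lemma sd_1mul : right_id sd_one sd_mul.
Proof. by case=> g h; rewrite /sd_mul /= xact_one !mulg1. Qed.
Lemma sd_mulVg : left_inverse sd_one sd_inv sd_mul.
Proof. by case=> g h; rewrite /sd_mul /= -xact_mul !mulVg xact_one. Qed.
Lemma sd_mulgV : right_inverse sd_one sd_inv sd_mul.
Proof. by case=> g h; rewrite /sd_mul /= -xactM !mulgV xact1 mulgV. Qed.

HB.instance Definition _ := isGroup.Build (semidirect X)
  sd_mulA sd_mul1 sd_1mul sd_mulVg sd_mulgV.

End SemiDirect.

(* The 2-group presented by [X], as a categorical group: a morphism  (gamma, chi)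
   goes from  gamma  to  xbd chi * gamma, composition is vertical composition. *)
Section TwoGroup.
Variables (G H : groupType) (X : crossed_module G H).

Definition two_group : category.
Proof.
refine (@Category G (semidirect X)
  (fun m => m.1) (fun m => xbd X m.2 * m.1) (fun g => (g, 1))
  (fun m' m _ => (m.1, m'.2 * m.2)) _ _ _ _ _ _ _).
- by [].
- by move=> g /=; rewrite xbd1 mul1g.
- by [].
- by move=> m' m p /=; rewrite gmulfM p mulgA.
- by case=> g h p /=; rewrite mul1g.
- by case=> g h p /=; rewrite mulg1.
- by move=> m'' m' m p q p' q' /=; rewrite mulgA.
Defined.

(* The monoidal product: multiplication in  G  on objects, horizontal
   composition, that is multiplication in  G |>< H, on morphisms. *)
Definition two_group_tensor : functor (prod_cat two_group two_group) two_group.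
Proof.
refine (@Functor (prod_cat two_group two_group) two_group
  (fun g => (g.1 * g.2)%g) (fun m => ((m.1 : semidirect X) * m.2)%g) _ _ _ _).
- by [].
- move=> [[g h] [g' h']] /=.
  by rewrite gmulfM xbd_act !mulgA mulgVK.
- by move=> [g g'] /=; congr pair; rewrite /= xact_one mulg1.
- move=> [[g1 h1] [g2 h2]] [[g3 h3] [g4 h4]] /= [p1 p2] q; congr pair => /=.
  by rewrite p1 xactM peiffer xact_mul !mulgA mulgVK.
Defined.

End TwoGroup.

Section NatTrans.
Variables C D : category.

Record nat_trans (F F' : functor C D) := NatTrans {
  nt : Ob C -> Mor D;
  nt_src : forall x, src (nt x) = fob F x;
  nt_tgt : forall x, tgt (nt x) = fob F' x;
  nt_nat : forall f (p : src (nt (tgt f)) = tgt (fmor F f))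
      (q : src (fmor F' f) = tgt (nt (src f))),
    compm (nt (tgt f)) (fmor F f) p = compm (fmor F' f) (nt (src f)) q
}.

End NatTrans.

Lemma compA_congr (C : category) (h g f k l : Mor C) p q p' r s :
  compm g f p = compm k l r -> compm h (compm g f p) q = compm (compm h k p') l s.
Proof.
move=> e; have q2 : src h = tgt (compm k l r) by rewrite -e.
by rewrite (comp_congr q q2 erefl e); exact: comp_assoc.
Qed.

Section NatTransOps.
Variables C D : category.

Definition nt_id (F : functor C D) : nat_trans F F.
Proof.
refine (@NatTrans C D F F (fun x => idm (fob F x)) _ _ _).
- by move=> x; rewrite src_idm.
- by move=> x; rewrite tgt_idm.
- move=> f p q.
  have p' : src (idm (tgt (fmor F f))) = tgt (fmor F f) by rewrite src_idm.
  have q' : src (fmor F f) = tgt (idm (src (fmor F f))) by rewrite tgt_idm.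
  transitivity (fmor F f).
    by rewrite -[RHS](comp_idl p'); apply: comp_congr; rewrite // fmor_tgt.
  by rewrite -[LHS](comp_idr q'); apply: comp_congr; rewrite // fmor_src.
Defined.

Lemma nt_vcomp_composable (F F' F'' : functor C D)
    (b : nat_trans F' F'') (a : nat_trans F F') x :
  src (nt b x) = tgt (nt a x).
Proof. by rewrite nt_src nt_tgt. Qed.

Definition nt_vcomp (F F' F'' : functor C D)
    (b : nat_trans F' F'') (a : nat_trans F F') : nat_trans F F''.
Proof.
refine (@NatTrans C D F F''
  (fun x => compm (nt b x) (nt a x) (nt_vcomp_composable b a x)) _ _ _).
- by move=> x; rewrite src_comp nt_src.
- by move=> x; rewrite tgt_comp nt_tgt.
- move=> f p q.
  have p1 : src (nt a (tgt f)) = tgt (fmor F f) by rewrite nt_src fmor_tgt.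
  have q1 : src (fmor F' f) = tgt (nt a (src f)) by rewrite nt_tgt fmor_src.
  have p2 : src (nt b (tgt f)) = tgt (fmor F' f) by rewrite nt_src fmor_tgt.
  have q2 : src (fmor F'' f) = tgt (nt b (src f)) by rewrite nt_tgt fmor_src.
  have p3 : src (nt b (tgt f)) = tgt (compm _ _ p1).
    by rewrite tgt_comp nt_src nt_tgt.
  rewrite -(comp_assoc p3 p).
  have q3 : src (compm _ _ p2) = tgt (nt a (src f)).
    by rewrite src_comp fmor_src nt_tgt.
  rewrite (compA_congr p3 q3 (nt_nat p1 q1)).
  have q4 : src (compm _ _ q2) = tgt (nt a (src f)).
    by rewrite src_comp nt_src nt_tgt.
  rewrite (comp_congr q3 q4 (nt_nat p2 q2) erefl).
  by rewrite -(comp_assoc q q4).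
Defined.

End NatTransOps.

Section HComp.
Variables (B C D : category) (K K' : functor C D) (F F' : functor B C).
Variables (b : nat_trans K K') (a : nat_trans F F').

Lemma nt_hcomp_composable x : src (nt b (fob F' x)) = tgt (fmor K (nt a x)).
Proof. by rewrite nt_src fmor_tgt nt_tgt. Qed.

Definition nt_hcomp : nat_trans (functor_comp K F) (functor_comp K' F').
Proof.
refine (@NatTrans B D (functor_comp K F) (functor_comp K' F')
  (fun x => compm (nt b (fob F' x)) (fmor K (nt a x)) (nt_hcomp_composable x))
  _ _ _).
- by move=> x; rewrite src_comp fmor_src nt_src.
- by move=> x; rewrite tgt_comp nt_tgt.
- move=> f /= p q.
  have p1 : src (nt a (tgt f)) = tgt (fmor F f) by rewrite nt_src fmor_tgt.
  have q1 : src (fmor F' f) = tgt (nt a (src f)) by rewrite nt_tgt fmor_src.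
  have e := congr1 (fmor K) (nt_nat p1 q1).
  have p2 : src (fmor K (nt a (tgt f))) = tgt (fmor K (fmor F f)).
    by rewrite fmor_src fmor_tgt p1.
  have q2 : src (fmor K (fmor F' f)) = tgt (fmor K (nt a (src f))).
    by rewrite fmor_src fmor_tgt q1.
  rewrite (fmor_comp p1 p2) (fmor_comp q1 q2) in e.
  have p3 : src (nt b (fob F' (tgt f))) = tgt (compm _ _ p2).
    by rewrite tgt_comp nt_hcomp_composable.
  rewrite -(comp_assoc p3 p).
  have p4 : src (nt b (fob F' (tgt f))) = tgt (fmor K (fmor F' f)).
    by rewrite nt_src !fmor_tgt.
  have p5 : src (compm _ _ p4) = tgt (fmor K (nt a (src f))).
    by rewrite src_comp q2.
  rewrite (compA_congr p3 p5 e).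
  have p6 : src (nt b (tgt (fmor F' f))) = tgt (fmor K (fmor F' f)).
    by rewrite nt_src [RHS]fmor_tgt.
  have p7 : src (fmor K' (fmor F' f)) = tgt (nt b (src (fmor F' f))).
    by rewrite nt_tgt [LHS]fmor_src.
  have p8 : src (nt b (src (fmor F' f))) = tgt (fmor K (nt a (src f))).
    by rewrite nt_src -q2 [RHS]fmor_src.
  have p9 : src (compm _ _ p7) = tgt (fmor K (nt a (src f))) by rewrite src_comp.
  have -> : compm (compm _ _ p4) (fmor K (nt a (src f))) p5 =
            compm (compm _ _ p7) (fmor K (nt a (src f))) p9.
    apply: comp_congr => //; rewrite -(nt_nat p6 p7).
    by apply: comp_congr; rewrite // fmor_tgt.
  have p10 : src (fmor K' (fmor F' f)) = tgt (compm _ _ p8).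
    by rewrite tgt_comp p7.
  rewrite -(comp_assoc p10 p9); apply: comp_congr => //.
  by apply: comp_congr; rewrite // fmor_src.
Defined.

End HComp.

(* A strict 2-functor from the 2-group to Cat sending its object to C.  Its
   values on 2-morphisms are compared through their components, the source and
   target functors of the two sides agreeing by [sa_funM] and the axioms of [X]. *)
Record strict_action (G H : groupType) (X : crossed_module G H) (C : category) :=
  StrictAction {
  sa_fun : G -> functor C C;
  sa_nt : forall g chi, nat_trans (sa_fun g) (sa_fun (xbd X chi * g));
  sa_fun1 : sa_fun 1 = functor_id C;
  sa_funM : forall g g', sa_fun (g * g') = functor_comp (sa_fun g) (sa_fun g');
  sa_nt1 : forall g, nt (sa_nt g 1) = nt (nt_id (sa_fun g));
  sa_nt_v : forall g chi chi',
    nt (sa_nt g (chi' * chi)) =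
      nt (nt_vcomp (sa_nt (xbd X chi * g) chi') (sa_nt g chi));
  sa_nt_h : forall g1 chi1 g3 chi2,
    nt (sa_nt (g1 * g3) (chi1 * xact X g1 chi2)) =
      nt (nt_hcomp (sa_nt g1 chi1) (sa_nt g3 chi2))
}.

Lemma comp4_congr (C : category) (a b c d b2 c2 : Mor C) p q s r r' p' q' s' :
  compm b c r = compm c2 b2 r' ->
  compm (compm a b p) (compm c d q) s = compm (compm a c2 p') (compm b2 d q') s'.
Proof.
have aux (u v w : Mor C) p1 q1 s1 r1 p2 q2 :
    compm (compm a u p1) (compm v d q1) s1 = compm (compm a (compm u v r1) p2) d q2.
  have p3 : src (compm a u p1) = tgt v by rewrite src_comp.
  have p4 : src (compm (compm a u p1) v p3) = tgt d by rewrite src_comp.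
  rewrite (comp_assoc s1 p4); apply: comp_congr => //.
  by rewrite -(comp_assoc p2 p3).
move=> e.
have p2 : src a = tgt (compm b c r) by rewrite tgt_comp.
have q2 : src (compm a _ p2) = tgt d by rewrite src_comp src_comp.
have p3 : src a = tgt (compm c2 b2 r') by rewrite tgt_comp.
have q3 : src (compm a _ p3) = tgt d by rewrite src_comp src_comp.
rewrite (aux b c a p q s r p2 q2) (aux c2 b2 a p' q' s' r' p3 q3).
by apply: comp_congr => //; apply: comp_congr.
Qed.

Section ActionFunctor.
Variables (G H : groupType) (X : crossed_module G H) (C : category).
Variable Phi : strict_action X C.

Lemma action_composable (m : semidirect X) (f : Mor C) :
  src (nt (sa_nt Phi m.1 m.2) (tgt f)) = tgt (fmor (sa_fun Phi m.1) f).
Proof. by rewrite nt_src fmor_tgt. Qed.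

Definition action_mor (m : semidirect X) (f : Mor C) : Mor C :=
  compm (nt (sa_nt Phi m.1 m.2) (tgt f)) (fmor (sa_fun Phi m.1) f)
    (action_composable m f).

Definition action_functor : functor (prod_cat (two_group X) C) C.
Proof.
refine (@Functor (prod_cat (two_group X) C) C
  (fun x => fob (sa_fun Phi x.1) x.2) (fun m => action_mor m.1 m.2) _ _ _ _).
- by move=> [m f]; rewrite /action_mor src_comp fmor_src.
- by move=> [m f]; rewrite /action_mor tgt_comp nt_tgt.
- move=> [g x]; rewrite /action_mor /=.
  have p : src (idm (fob (sa_fun Phi g) x)) = tgt (idm (fob (sa_fun Phi g) x)).
    by rewrite src_idm tgt_idm.
  rewrite (@comp_congr _ _ (idm (fob (sa_fun Phi g) x)) _
    (idm (fob (sa_fun Phi g) x)) _ p); last by rewrite fmor_idm.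
    have p' : src (idm (tgt (idm (fob (sa_fun Phi g) x)))) =
              tgt (idm (fob (sa_fun Phi g) x)) by rewrite src_idm.
    by rewrite -[RHS](comp_idl p'); apply: comp_congr; rewrite // tgt_idm.
  by rewrite sa_nt1 /= tgt_idm.
- move=> [[g' h'] f'] [[g h] f] p q.
  have [p1 p2] := prod_cat_composable p.
  move: p q; rewrite /= in p1 p2; subst g' => p q; rewrite /action_mor /=.
  pose Fg := sa_fun Phi g; pose Fg' := sa_fun Phi (xbd X h * g).
  have r1 : src (fmor Fg f') = tgt (fmor Fg f).
    by rewrite fmor_src fmor_tgt p2.
  have r2 : src (nt (sa_nt Phi g h) (tgt f')) = tgt (fmor Fg f').
    by rewrite nt_src fmor_tgt.
  have r3 : src (fmor Fg' f') = tgt (nt (sa_nt Phi g h) (src f')).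
    by rewrite nt_tgt fmor_src.
  have r4 : src (nt (sa_nt Phi g h) (tgt f)) = tgt (fmor Fg f).
    by rewrite nt_src fmor_tgt.
  have r5 : src (fmor Fg' f') = tgt (nt (sa_nt Phi g h) (tgt f)).
    by rewrite -p2.
  have e : compm (fmor Fg' f') (nt (sa_nt Phi g h) (tgt f)) r5 =
           compm (nt (sa_nt Phi g h) (tgt f')) (fmor Fg f') r2.
    by rewrite (nt_nat r2 r3); apply: comp_congr; rewrite // p2.
  have s1 : src (nt (sa_nt Phi (xbd X h * g) h') (tgt f')) =
            tgt (nt (sa_nt Phi g h) (tgt f')) by rewrite nt_src nt_tgt.
  have s2 : src (compm _ _ s1) = tgt (compm _ _ r1).
    by rewrite src_comp tgt_comp.
  transitivity (compm (compm _ _ s1) (compm _ _ r1) s2).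
    apply: comp_congr; last exact: fmor_comp.
    by rewrite tgt_comp sa_nt_v /=; exact: comp_congr.
  by symmetry; apply: comp4_congr e.
Defined.

Lemma action_mor1 f : action_mor 1 f = f.
Proof.
rewrite /action_mor.
have p : src (idm (tgt f)) = tgt f by rewrite src_idm.
rewrite -[RHS](comp_idl p); apply: comp_congr.
  by rewrite /= sa_nt1 sa_fun1.
by rewrite /= sa_fun1.
Qed.

Lemma action_morM m' m f : action_mor (m' * m) f = action_mor m' (action_mor m f).
Proof.
case: m' m => [g1 h1] [g3 h2]; rewrite /action_mor /=.
set a := nt (sa_nt Phi g1 h1) _; set b := nt (sa_nt Phi g3 h2) _.
set F1 := sa_fun Phi g1; set F3 := sa_fun Phi g3.
have p1 : src b = tgt (fmor F3 f) by rewrite nt_src fmor_tgt.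
have p2 : src (fmor F1 b) = tgt (fmor F1 (fmor F3 f)).
  by rewrite fmor_src p1 [RHS]fmor_tgt.
have p3 : src a = tgt (compm _ _ p2).
  by rewrite nt_src !tgt_comp [RHS]fmor_tgt.
have p4 : src a = tgt (fmor F1 b) by rewrite p3 tgt_comp.
have p5 : src (compm _ _ p4) = tgt (fmor F1 (fmor F3 f)) by rewrite src_comp p2.
transitivity (compm (compm _ _ p4) _ p5); last first.
  rewrite -(comp_assoc p3 p5); apply: comp_congr => //.
  by rewrite -(fmor_comp p1 p2); congr fmor; exact: comp_congr.
apply: comp_congr; last by rewrite sa_funM.
rewrite sa_nt_h /=; apply: comp_congr => //.
by rewrite /a tgt_comp nt_tgt.
Qed.

Lemma action_ob1 x : fob (sa_fun Phi 1) x = x.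
Proof. by rewrite sa_fun1. Qed.

Lemma action_obM g' g x :
  fob (sa_fun Phi (g' * g)) x = fob (sa_fun Phi g') (fob (sa_fun Phi g) x).
Proof. by rewrite sa_funM. Qed.

(* The transformation Cat-groupoid. *)
Definition trans_s : functor (prod_cat (two_group X) C) C := prod_snd (two_group X) C.

Definition trans_e : functor C (prod_cat (two_group X) C).
Proof.
refine (@Functor C (prod_cat (two_group X) C)
  (fun x => (1, x)) (fun f => (1, f)) _ _ _ _).
- by [].
- by move=> f; rewrite /= xbd1 mulg1.
- by [].
- move=> g f p q /=; congr pair; last exact: comp_congr.
  by congr pair; rewrite mulg1.
Defined.

Definition trans_c :
  functor (pullback trans_s action_functor) (prod_cat (two_group X) C).
Proof.
refine (@Functor (pullback trans_s action_functor) (prod_cat (two_group X) C)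
  (fun x => (fob (two_group_tensor X) ((sval x).1.1, (sval x).2.1), (sval x).2.2))
  (fun m => (fmor (two_group_tensor X) ((sval m).1.1, (sval m).2.1), (sval m).2.2))
  _ _ _ _).
- move=> [[[m' f'] [m f]] p]; congr pair.
- move=> [[[m' f'] [m f]] p]; congr pair.
  exact: (fmor_tgt (two_group_tensor X) (m', m)).
- move=> [[[g' x'] [g x]] p]; congr pair.
  exact: (fmor_idm (two_group_tensor X) (g', g)).
- move=> [[[n' k'] [n k]] pn] [[[m' f'] [m f]] pm] p q.
  congr pair; last exact: comp_congr.
  have /= [p1 p2] := pb_composable p.
  case: p1 p2 => [r1 _] [r2 _].
  pose N : Mor (prod_cat (two_group X) (two_group X)) := (n', n).
  pose M : Mor (prod_cat (two_group X) (two_group X)) := (m', m).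
  have r : src N = tgt M by congr pair.
  have r' : src (fmor (two_group_tensor X) N) = tgt (fmor (two_group_tensor X) M).
    by rewrite fmor_src fmor_tgt r.
  exact: (fmor_comp r r').
Defined.

Lemma trans_cat_axioms :
  @is_internal_cat Cat C (prod_cat (two_group X) C) trans_s action_functor
    trans_e trans_c.
Proof.
split.
- exact: functor_eq.
- by apply: functor_eq => x /=; [exact: action_ob1 | exact: action_mor1].
- exact: functor_eq.
- apply: functor_eq => [] [[[g' x'] [g x]] p] /=.
    by rewrite action_obM; congr fob.
  by rewrite (action_morM g' g); congr action_mor.
- by move=> p; apply: functor_eq => [] [m f] /=; rewrite mul1g.
- by move=> p; apply: functor_eq => [] [m f] /=; rewrite mulg1.
- by move=> pr12 h g f p q r; apply: functor_eq => x /=; rewrite mulgA.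
Qed.

Definition trans_inverse :
  functor (prod_cat (two_group X) C) (prod_cat (two_group X) C).
Proof.
refine (@Functor (prod_cat (two_group X) C) (prod_cat (two_group X) C)
  (fun x => (x.1^-1, fob action_functor x))
  (fun m => ((m.1 : semidirect X)^-1, fmor action_functor m)) _ _ _ _).
- by move=> [[g h] f]; congr pair; exact: (fmor_src action_functor).
- move=> [[g h] f]; congr pair; last exact: (fmor_tgt action_functor).
  by rewrite /= xbd_act invgK -mulgA mulgV mulg1 invgM xbdV.
- move=> [g x]; congr pair; last exact: (fmor_idm action_functor (g, x)).
  by congr pair; rewrite /= invg1 xact_one.
- move=> [[g' h'] f'] [[g h] f] p q.
  congr pair; last exact: fmor_comp.
  have /= [p1 _] := prod_cat_composable p.
  congr pair; rewrite /= p1 [(_ * g)^-1]invgM xactM -xact_mul; congr xact.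
  by rewrite -xbdV peiffer mulgVK invgM.
Defined.

Definition trans_cat : internal_cat Cat := InternalCat trans_cat_axioms.

Lemma trans_cat_inverse : let s := ic_s trans_cat in let t := ic_t trans_cat in
    exists i : pc_hom (ic_mor trans_cat) (ic_mor trans_cat),
    exists (p : s \oc i = t \oc pc_id _) (q : s \oc pc_id _ = t \oc i),
      ic_c trans_cat \oc pc_pair p = ic_e trans_cat \oc s /\
      ic_c trans_cat \oc pc_pair q = ic_e trans_cat \oc t.
Proof.
move=> s t; exists trans_inverse.
have p : functor_comp trans_s trans_inverse =
    functor_comp action_functor (functor_id _) by exact: functor_eq.
have q : functor_comp trans_s (functor_id _) =
    functor_comp action_functor trans_inverse.
  apply: functor_eq => [] [m f] /=; first by rewrite -action_obM mulVg action_ob1.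
  by rewrite -action_morM mulVg action_mor1.
exists p, q; split; apply: functor_eq => x /=.
- by rewrite mulVg.
- by rewrite mulVg.
- by rewrite mulgV.
- by rewrite mulgV.
Qed.

Definition trans_cat_groupoid : internal_groupoid Cat :=
  InternalGroupoid trans_cat_inverse.

End ActionFunctor.

Definition is_group_action (K : groupType) (S : Type) (a : K -> S -> S) : Prop :=
  (forall x, a 1 x = x) /\ (forall k' k x, a (k' * k) x = a k' (a k x)).

Section TransGroupoid.
Variables (K : groupType) (S : Type) (a : K -> S -> S).
Hypothesis act : is_group_action a.

Definition trans_category : category.
Proof.
refine (@Category S (K * S)%type (fun m => m.2) (fun m => a m.1 m.2)
  (fun x => (1, x)) (fun m' m _ => (m'.1 * m.1, m.2)) _ _ _ _ _ _ _).
- by [].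
- by move=> x; exact: act.1.
- by [].
- by move=> m' m p /=; rewrite act.2 p.
- by case=> k x p /=; rewrite mul1g.
- by case=> k x p /=; rewrite mulg1.
- by move=> m'' m' m p q p' q' /=; rewrite mulgA.
Defined.

Lemma trans_category_groupoid : is_groupoid trans_category.
Proof.
move=> [k x]; exists (k^-1, a k x).
have p : src ((k^-1, a k x) : Mor trans_category) = tgt ((k, x) : Mor trans_category).
  by [].
have q : src ((k, x) : Mor trans_category) = tgt ((k^-1, a k x) : Mor trans_category).
  by rewrite /= -act.2 mulVg act.1.
by exists p, q; rewrite /= mulVg mulgV.
Qed.

Definition trans_groupoid : groupoid := @FullOb Cat is_groupoid _ trans_category_groupoid.

End TransGroupoid.

(* Main.v *)
(* The structure functors of the transformation Cat-groupoid are, on objects and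
   on morphisms separately, the structure maps of the transformation groupoids
   of the actions of G on the objects and of G |>< H on the morphisms of C.  So
   the two categories underlying the transpose coincide with these
   transformation groupoids up to the proofs of the category laws, and proof
   irrelevance turns this into an equality of internal categories. *)
Require Import Defs.
From HB Require Import structures.
From mathcomp Require Import all_boot.
From mathcomp Require Import boolp.

Set Implicit Arguments.
Unset Strict Implicit.
Unset Printing Implicit Defensive.

(** Converse of [is_internal_cat_of_full]: homs, composites and chosen pullbacks of a full
    subcategory are those of [E], so each axiom transfers by conversion. *)
Lemma is_internal_cat_full (E : pullback_category) (P : E -> Prop)
    (P_pb : forall (a b c : E) (s : pc_hom a c) (t : pc_hom b c),
      P a -> P b -> P (pc_pb s t))
    (D0 D1 : full_sub P_pb)
    (s t : pc_hom (fs_val D1) (fs_val D0)) (e : pc_hom (fs_val D0) (fs_val D1))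
    (c : pc_hom (pc_pb s t) (fs_val D1)) :
  is_internal_cat e c -> @is_internal_cat (full_sub P_pb) D0 D1 s t e c.
Proof.
by case=> a1 a2 a3 a4 a5 a6 a7; split;
  [exact a1|exact a2|exact a3|exact a4|exact a5|exact a6|exact a7].
Qed.

Section TransposeIrrelevance.
Variable D : internal_cat Cat.

Let D0 : category := ic_ob D.
Let D1 : category := ic_mor D.
Let s : functor D1 D0 := ic_s D.
Let t : functor D1 D0 := ic_t D.
Let e : functor D0 D1 := ic_e D.
Let c : functor (pullback s t) D1 := ic_c D.

(* The categories [transpose_ob D] and [transpose_mor D], awaiting the proofs of
   the category laws. *)
Definition transpose_ob_with :=
  @Category (Ob D0) (Ob D1) (fob s) (fob t) (fob e)
    (fun g f p => fob c (exist _ (g, f) p)).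
Definition transpose_mor_with :=
  @Category (Mor D0) (Mor D1) (fmor s) (fmor t) (fmor e)
    (fun g f p => fmor c (exist _ (g, f) p)).

(** The law proofs are left arbitrary so that any categories with the same data as the transpose can
    be plugged in by unification, with no functor transported along an equality of categories. *)
Lemma transpose_with a1 a2 a3 a4 a5 a6 a7 b1 b2 b3 b4 b5 b6 b7
    (X0 := transpose_ob_with a1 a2 a3 a4 a5 a6 a7)
    (X1 := transpose_mor_with b1 b2 b3 b4 b5 b6 b7)
    (gX0 : is_groupoid X0) (gX1 : is_groupoid X1)
    (Y0 := @FullOb Cat is_groupoid X0 gX0) (Y1 := @FullOb Cat is_groupoid X1 gX1) :
  exists (s' t' : functor X1 X0) (e' : functor X0 X1)
         (c' : functor (pullback s' t') X1)
         (ax : is_internal_cat (E := Gpd) (D0 := Y0) (D1 := Y1) e' c'),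
    [/\ internal_cat_of_Gpd (InternalCat ax) = transpose D,
        (forall x : Ob D0, fob e' x = idm x) /\
        (forall a : Ob D1, fmor e' a = idm a),
        (forall f : Mor D0, fob s' f = src f) /\
        (forall m : Mor D1, fmor s' m = src m),
        (forall f : Mor D0, fob t' f = tgt f) /\
        (forall m : Mor D1, fmor t' m = tgt m) &
        (forall (f' f : Mor D0) (p : fob s' f' = fob t' f) (q : src f' = tgt f),
           fob c' (exist _ (f', f) p) = compm f' f q) /\
        (forall (m' m : Mor D1) (p : fmor s' m' = fmor t' m)
                (q : src m' = tgt m),
           fmor c' (exist _ (m', m) p) = compm m' m q)].
Proof.
pose T0 := transpose_ob D; pose T1 := transpose_mor D.
rewrite {}/Y0 {}/Y1; move: gX0 gX1; rewrite {}/X0 {}/X1.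
(* Once every law proof is the one carried by [T0] or [T1], the two categories are convertible to
   [T0] and [T1], and the structure functors of the transpose typecheck as witnesses. *)
have -> : a1 = @src_idm T0 by exact: Prop_irrelevance.
have -> : a2 = @tgt_idm T0 by exact: Prop_irrelevance.
have -> : a3 = @src_comp T0 by exact: Prop_irrelevance.
have -> : a4 = @tgt_comp T0 by exact: Prop_irrelevance.
have -> : a5 = @comp_idl T0 by exact: Prop_irrelevance.
have -> : a6 = @comp_idr T0 by exact: Prop_irrelevance.
have -> : a7 = @comp_assoc T0 by exact: Prop_irrelevance.
have -> : b1 = @src_idm T1 by exact: Prop_irrelevance.
have -> : b2 = @tgt_idm T1 by exact: Prop_irrelevance.
have -> : b3 = @src_comp T1 by exact: Prop_irrelevance.
have -> : b4 = @tgt_comp T1 by exact: Prop_irrelevance.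
have -> : b5 = @comp_idl T1 by exact: Prop_irrelevance.
have -> : b6 = @comp_idr T1 by exact: Prop_irrelevance.
have -> : b7 = @comp_assoc T1 by exact: Prop_irrelevance.
rewrite -[transpose_ob_with _ _ _ _ _ _ _]/T0.
rewrite -[transpose_mor_with _ _ _ _ _ _ _]/T1 => gT0 gT1.
exists (transpose_s D), (transpose_t D), (transpose_e D), (transpose_c D).
have ax := @is_internal_cat_full Cat is_groupoid pullback_is_groupoid
  (FullOb gT0) (FullOb gT1) _ _ _ _ (transpose_axioms D).
exists ax; split; try by split.
  (* Both sides have the same data; only the proofs of the axioms differ. *)
  by congr InternalCat; exact: Prop_irrelevance.
by split=> m' m p q; [exact: (@comp_congr D0) | exact: (@comp_congr D1)].
Qed.

End TransposeIrrelevance.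

Theorem theorem4p8 (G H : groupType) (X : crossed_module G H) (C : category)
    (Phi : strict_action X C) :
  let GxC : category := prod_cat (two_group X) C in
  exists (act0 : is_group_action (K := G) (S := Ob C)
                   (fun g x => fob (action_functor Phi) (g, x)))
         (act1 : is_group_action (K := semidirect X) (S := Mor C)
                   (fun m f => fmor (action_functor Phi) (m, f))),
  let X0 : groupoid := trans_groupoid act0 in
  let X1 : groupoid := trans_groupoid act1 in
  exists (s t : functor X1 X0) (e : functor X0 X1)
         (c : functor (pullback s t) X1)
         (ax : is_internal_cat (E := Gpd) (D0 := X0) (D1 := X1) e c),
    [/\ internal_cat_of_Gpd (InternalCat ax) = transpose (trans_cat_groupoid Phi),
        (forall x : Ob C, fob e x = idm x) /\
        (forall a : Ob GxC, fmor e a = idm a),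
        (forall f : Mor C, fob s f = src f) /\
        (forall m : Mor GxC, fmor s m = src m),
        (forall f : Mor C, fob t f = tgt f) /\
        (forall m : Mor GxC, fmor t m = tgt m) &
        (forall (f' f : Mor C) (p : fob s f' = fob t f) (q : src f' = tgt f),
           fob c (exist _ (f', f) p) = compm f' f q) /\
        (forall (m' m : Mor GxC) (p : fmor s m' = fmor t m)
                (q : src m' = tgt m),
           fmor c (exist _ (m', m) p) = compm m' m q)].
Proof.
move=> GxC.
have act0 : is_group_action (K := G) (S := Ob C)
    (fun g x => fob (action_functor Phi) (g, x)).
  by split; [exact: action_ob1 | exact: action_obM].
have act1 : is_group_action (K := semidirect X) (S := Mor C)
    (fun m f => fmor (action_functor Phi) (m, f)).
  by split; [exact: action_mor1 | exact: action_morM].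
exists act0, act1.
(* The groupoid proofs determine the fourteen law proofs: the source, target, identity and
   composition of each [trans_category] are convertible to the object or morphism maps of [trans_s],
   [action_functor], [trans_e] and [trans_c]. *)
exact: (@transpose_with (trans_cat_groupoid Phi) _ _ _ _ _ _ _ _ _ _ _ _ _ _
  (@trans_category_groupoid _ _ _ act0) (@trans_category_groupoid _ _ _ act1)).
Qed.
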